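(* For any positive integers $j\le r$ and all $0<z<1$, \[ {\rm A}\left(\{1\}_{j-1},2,\{1\}_{r-j};\frac{1-z}{1+z}\right)=\sum_{i=0}^{r-j}(-1)^i\binom{i+j}{i}T(i+j+1)\,{\rm A}\left(\{1\}_{r-j-i};\frac{1-z}{1+z}\right)+(-1)^{r-j-1}\sum_{l=r-j}^{r}\binom{l}{r-j}{\rm A}\left(\{1\}_{r-l};\frac{1-z}{1+z}\right){\rm A}(l+1;z). \]
   Context: For an index $(k_1,\ldots,k_r)$ and $z\in[-1,1)$, ${\rm A}(k_1,\ldots,k_r;z)=2^r\sum_{1\le n_1<\cdots<n_r,\ n_i\equiv i \pmod 2}\frac{z^{n_r}}{n_1^{k_1}\cdots n_r^{k_r}}$; ${\rm A}(\emptyset;z)=1$; $\{1\}_j$ denotes $j$ repetitions of $1$. For an integer $n\ge2$, $T(n)=2\sum_{m\ge1,\ m\text{ odd}}m^{-n}$. *)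

(* Defs.v *)
From mathcomp Require Import all_boot all_order all_algebra.
From mathcomp Require Import all_classical all_reals all_analysis.

Set Implicit Arguments.
Unset Strict Implicit.
Unset Printing Implicit Defensive.

Import Order.TTheory GRing.Theory Num.Theory numFieldNormedType.Exports.
Local Open Scope ring_scope.

(* Positions in a seq are numbered from 0, so the (i+1)-st entry, nth 0 s i,
   must have the parity of i.+1. *)
Definition admissible (s : seq nat) : bool :=
  [&& all (leq 1) s, sorted ltn s
    & [forall i : 'I_(size s), odd (nth 0%N s i) == odd i.+1]].

(* The part of the sum defining A(k; z) with n_r < N.  For k = [::] it is 1:
   the empty tuple contributes z ^+ 0 times an empty product. *)
Definition Apart (R : realType) (k : seq nat) (z : R) (N : nat) : R :=
  2 ^+ size k *
  \sum_(n : (size k).-tuple 'I_N | admissible (map val n))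
    z ^+ last 0%N (map val n) /
    \prod_(i < size k) ((tnth n i)%:R ^+ nth 0%N k i).

(* Meaningful for -1 <= z < 1, where the partial sums converge (possibly only
   conditionally at z = -1, hence the truncation by the largest variable). *)
Definition A (R : realType) (k : seq nat) (z : R) : R := limn (Apart k z).

Definition T (R : realType) (n : nat) : R :=
  2 * limn (fun N : nat => \sum_(1 <= m < N | odd m) (m%:R ^- n : R)).

(* Main.v *)
Require Import Defs.
From mathcomp Require Import all_boot all_order all_algebra.
From mathcomp Require Import all_classical all_reals all_analysis.
From mathcomp Require Import ring lra zify.
Import Order.TTheory GRing.Theory Num.Theory numFieldNormedType.Exports.
Local Open Scope ring_scope.

(** Differentiating the power series A(k; x) in x either lowers the last
    exponent (with factor 1/x) or, if that exponent is 1, removes it (with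
    factor 2/(1 - x^2)).  The substitution x = (1 - z)/(1 + z) exchanges, up to
    sign, the forms dx/x and 2dx/(1 - x^2), so in the variable z the left-hand
    side with m = r - j trailing ones has derivative -1/z times the one with
    m - 1; by Pascal's rule the right-hand side telescopes to the same
    recursion.  Both sides tend to 0 as z -> 1-, the last two terms on the right
    cancelling because A(n; z) tends to T(n) by Abel's theorem; hence they agree
    by induction on m. *)

Set Implicit Arguments.
Unset Strict Implicit.
Unset Printing Implicit Defensive.

(** * Splitting off the largest summation variable *)

(** Positivity and strict increase together say that the sequence is a [ltn]-path from 0, so for
    empty [s] the comparison with the default 0 is the positivity test. *)
Lemma admissible_rcons (s : seq nat) (x : nat) :
  admissible (rcons s x) =
    [&& odd x == odd (size s).+1, admissible s & (last 0 s < x)%N].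
Proof.
have admE t : admissible t = path ltn 0 t &&
    all (fun i => odd (nth 0%N t i) == odd i.+1) (iota 0 (size t)).
  rewrite /admissible (path_sortedE ltn_trans) andbA; congr (_ && _).
  apply/forallP/allP => /= [h i|h i]; last by apply: h; rewrite mem_iota /=.
  by rewrite mem_iota /= => lt_i; exact: (h (Ordinal lt_i)).
rewrite !admE rcons_path size_rcons -addn1 iotaD all_cat /= nth_rcons ltnn eqxx.
rewrite andbT add0n addn1.
have -> : all (fun i => odd (nth 0%N (rcons s x) i) == odd i.+1)
               (iota 0 (size s)) =
          all (fun i => odd (nth 0%N s i) == odd i.+1) (iota 0 (size s)).
  by apply: eq_in_all => i; rewrite mem_iota /= nth_rcons => ->.
by rewrite [RHS]andbC -!andbA; do !bool_congr.
Qed.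

Section Coefficients.
Variable R : realType.

(* 2 ^ p times the sum over n_1 < ... < n_p = n; the parity and order
   conditions on n_1 are captured by starting from n_0 = 0. *)
Fixpoint ncoef (k : nat -> nat) (p n : nat) : R :=
  if p is q.+1 then
    2 * (odd n == odd p)%:R / n%:R ^+ k q * \sum_(0 <= m < n) ncoef k q m
  else (n == 0%N)%:R.

Lemma sum_tuple_rcons (V : nmodType) (T : finType) (p : nat) (F : p.+1.-tuple T -> V) :
  \sum_(t : p.+1.-tuple T) F t = \sum_(x : T) \sum_(t : p.-tuple T) F [tuple of rcons t x].
Proof.
rewrite exchange_big pair_big /=.
rewrite (reindex (fun u : p.-tuple T * T => [tuple of rcons u.1 u.2])) //=.
exists (fun t : p.+1.-tuple T =>
    ([tuple tnth t (widen_ord (leqnSn p) i) | i < p], tnth t ord_max))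
  => [[t x] _|t _] /=.
  congr (_, _); last by rewrite (tnth_nth x) /= nth_rcons size_tuple ltnn eqxx.
  apply: eq_from_tnth => i; rewrite tnth_mktuple !(tnth_nth x) /= nth_rcons size_tuple.
  by rewrite ltn_ord.
apply: val_inj => /=; apply: (@eq_from_nth _ (tnth t ord_max)).
  by rewrite size_rcons !size_tuple card_ord.
move=> i; rewrite size_rcons size_map size_enum_ord ltnS => le_ip.
rewrite nth_rcons size_map size_enum_ord.
case: ltnP => [lt_ip|le_pi].
  rewrite (nth_map (Ordinal lt_ip)) ?size_enum_ord // (tnth_nth (tnth t ord_max)) /=.
  by rewrite nth_enum_ord.
have -> : i = p by apply/eqP; rewrite eqn_leq le_ip.
by rewrite eqxx [LHS](tnth_nth (tnth t ord_max)).
Qed.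

(** The weight [f] is arbitrary because the induction hypothesis is applied to the indicator of
    being below the new last entry [x]. The bound is [N.+1] since for [p = 0] the empty tuple
    contributes [f 0]. *)
Lemma sum_admissible (k : nat -> nat) (p N : nat) (f : nat -> R) :
  2 ^+ p * \sum_(t : p.-tuple 'I_N.+1 | admissible (map val t))
    f (last 0%N (map val t)) / \prod_(i < p) ((tnth t i)%:R ^+ k i) =
  \sum_(0 <= n < N.+1) ncoef k p n * f n.
Proof.
elim: p f => [|p IHp] f.
  rewrite expr0 mul1r (bigD1 [tuple]) //=; last first.
    by rewrite /admissible /=; apply/forallP => -[].
  rewrite big_ord0 divr1 big1 ?addr0; last first.
    by move=> t /andP[_ /eqP[]]; exact: tuple0.
  rewrite big_nat_recl //= mul1r big1 ?addr0 // => i _.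
  by rewrite mul0r.
rewrite big_mkcond sum_tuple_rcons big_mkord mulr_sumr; apply: eq_bigr => x _ /=.
transitivity (2 * (odd x == odd p.+1)%:R / x%:R ^+ k p * f x *
  (2 ^+ p * \sum_(t : p.-tuple 'I_N.+1 | admissible (map val t))
    ((last 0%N (map val t) < x)%N%:R / \prod_(i < p) ((tnth t i)%:R ^+ k i))) : R).
  rewrite exprS [in RHS]mulrCA !mulrA [in LHS](mulrC 2) -!mulrA; congr (_ * _).
  rewrite !mulr_sumr [RHS]big_mkcond /=; apply: eq_bigr => t _.
  rewrite !map_rcons admissible_rcons last_rcons size_map size_tuple.
  case: eqP => _ /=; last by rewrite !(mul0r, mulr0) if_same.
  case: (admissible _) => //=; last by rewrite mulr0.
  case: ltnP => _ /=; last by rewrite !(mul0r, mulr0).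
  rewrite big_ord_recr /= !(tnth_nth x) /= nth_rcons size_tuple ltnn eqxx.
  under eq_bigr do rewrite (tnth_nth x) /= nth_rcons size_tuple ltn_ord -(tnth_nth x).
  rewrite invfM.
  by rewrite mul1r; ring.
rewrite (IHp (fun l => (l < x)%N%:R)) mulrAC; congr (_ * _); congr (_ * _).
rewrite (@big_cat_nat _ _ _ x) //=; last exact/ltnW/ltn_ord.
rewrite [X in _ + X]big_nat [X in _ + X]big1 ?addr0; last first.
  by move=> i /andP[le_xi _]; rewrite ltnNge le_xi mulr0.
by apply: eq_big_nat => i /andP[_ ->]; rewrite mulr1.
Qed.
End Coefficients.

(** * Power series on the open unit disk *)

Section PowerSeries.
Local Open Scope classical_set_scope.
Variable R : realType.
Implicit Types (c : nat -> R) (x : R).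

(** Equivalent to a radius of convergence at least 1. Unlike boundedness of the coefficients, this
    form is stable under formal differentiation. *)
Definition converges_on_disk c := forall rho : R, 0 < rho < 1 ->
  exists C, forall n, `|c n| * rho ^+ n <= C.

Lemma bounded_converges_on_disk c (C : R) :
  (forall n, `|c n| <= C) -> converges_on_disk c.
Proof.
move=> cC rho /andP[rho0 rho1]; exists C => n.
by rewrite (le_trans _ (cC n))// ler_piMr// exprn_ile1 // ltW.
Qed.

Lemma is_cvg_pseries_disk c x :
  converges_on_disk c -> `|x| < 1 -> cvgn (pseries c x).
Proof.
(* With [rho] strictly between the norm of [x] and 1, the terms are dominated by a geometric series
   of ratio [|x| / rho]. *)
move=> hc x1; pose rho := (1 + `|x|) / 2.
have x0 := normr_ge0 x.
have rho0 : 0 < rho by rewrite /rho; lra.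
have [C hC] : exists C, forall n, `|c n| * rho ^+ n <= C.
  by apply: hc; rewrite rho0 /rho; lra.
apply: normed_cvg.
have t0 : 0 <= `|x| / rho by rewrite divr_ge0 // ltW.
have C0 : 0 <= C by apply: le_trans (hC 0%N); rewrite mulr_ge0 // exprn_ge0 // ltW.
apply: (@series_le_cvg _ _ (geometric C (`|x| / rho))).
- by move=> n; exact: normr_ge0.
- by move=> n; rewrite /= mulr_ge0 ?exprn_ge0.
- move=> n /=; have xE : `|x| = `|x| / rho * rho by rewrite divfK // gt_eqF.
  rewrite normrM normrX {1}xE exprMn mulrCA mulrC.
  by rewrite ler_wpM2r ?exprn_ge0.
- apply: is_cvg_geometric_series.
  by rewrite ger0_norm // ltr_pdivrMr // mul1r /rho; lra.
Qed.

(** Each of the [n.+1] terms of [1 + t + ... + t ^+ n] is at least [t ^+ n]; multiply by [1 - t]. *)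
Lemma succ_mul_expr_le (t : R) n :
  0 <= t <= 1 -> n.+1%:R * t ^+ n * (1 - t) <= 1 - t ^+ n.+1.
Proof.
move=> /andP[t0 t1]; elim: n => [|n IHn]; first by rewrite expr0 expr1 !mul1r.
have := ler_wpM2l t0 IHn.
have : 0 <= (1 - t) * (1 - t ^+ n.+1).
  by rewrite mulr_ge0 ?subr_ge0 // exprn_ile1.
rewrite -[n.+2%:R]natr1 [t ^+ n.+2]exprS [t ^+ n.+1]exprS.
by move: (t ^+ n) (n.+1%:R : R) => u v; lra.
Qed.

(** Compare with a radius [sigma] between [rho] and 1: the factor [n.+1] is absorbed by the powers
    of [t = rho / sigma < 1]. *)
Lemma converges_on_disk_diffs c :
  converges_on_disk c -> converges_on_disk (pseries_diffs c).
Proof.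
move=> hc rho /andP[rho0 rho1]; pose sigma := (1 + rho) / 2.
have sigma0 : 0 < sigma by rewrite /sigma; lra.
have sigma1 : sigma < 1 by rewrite /sigma; lra.
have [|C hC] := hc sigma; first by rewrite sigma0.
have C0 : 0 <= C by apply: le_trans (hC 0%N); rewrite mulr_ge0 // exprn_ge0 // ltW.
pose t := rho / sigma.
have t0 : 0 <= t by rewrite divr_ge0 // ltW.
have t1 : t < 1 by rewrite ltr_pdivrMr // mul1r /sigma; lra.
have t1' : 0 < 1 - t by rewrite subr_gt0.
exists (C / sigma / (1 - t)) => n.
rewrite ler_pdivlMr // ler_pdivlMr // /pseries_diffs normrM normr_nat.
have -> : n.+1%:R * `|c n.+1| * rho ^+ n * (1 - t) * sigma =
    (`|c n.+1| * sigma ^+ n.+1) * (n.+1%:R * t ^+ n * (1 - t)).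
  have -> : rho = t * sigma by rewrite /t divfK // gt_eqF.
  by rewrite exprMn exprS; ring.
rewrite -[leRHS]mulr1; apply: ler_pM => //.
- by rewrite mulr_ge0 // exprn_ge0 // ltW.
- by rewrite !mulr_ge0 ?exprn_ge0 // ltW.
- apply: le_trans (succ_mul_expr_le n _) _; first by rewrite t0 ltW.
  by rewrite gerBl exprn_ge0.
Qed.

Lemma is_derive_pseries_disk c x : converges_on_disk c -> `|x| < 1 ->
  is_derive x 1 (fun y => limn (pseries c y)) (limn (pseries (pseries_diffs c) x)).
Proof.
move=> hc x1; have x0 := normr_ge0 x.
have K0 : 0 <= (1 + `|x|) / 2 by lra.
have K1 : `|(1 + `|x|) / 2| < 1 by rewrite ger0_norm //; lra.
(* Termwise differentiation requires the series and its first two formal derivatives to converge at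
   a point farther from 0 than [x]. *)
apply: (@pseries_snd_diffs _ _ ((1 + `|x|) / 2)).
- exact: is_cvg_pseries_disk.
- exact/is_cvg_pseries_disk/K1/converges_on_disk_diffs.
- exact/is_cvg_pseries_disk/K1/converges_on_disk_diffs/converges_on_disk_diffs.
- by rewrite [ltRHS]ger0_norm //; lra.
Qed.
End PowerSeries.

(** * The iterated sums as power series and their derivatives *)

Section IteratedSums.
Local Open Scope classical_set_scope.
Variable R : realType.
Implicit Types (s : seq nat) (x : R).

Definition Acoef s : nat -> R := ncoef R (nth 0%N s) (size s).

Lemma eq_ncoef (k k' : nat -> nat) p : (forall i, (i < p)%N -> k i = k' i) ->
  ncoef R k p =1 ncoef R k' p.
Proof.
elim: p => [|p IHp] kk' n //=; rewrite kk' //; congr (_ * _).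
by apply: eq_bigr => m _; apply: IHp => i ip; rewrite kk' // ltnW.
Qed.

Lemma Acoef_rcons s a n : Acoef (rcons s a) n =
  2 * (odd n == odd (size s).+1)%:R / n%:R ^+ a * \sum_(0 <= m < n) Acoef s m.
Proof.
rewrite /Acoef size_rcons /= nth_rcons ltnn eqxx; congr (_ * _).
by apply: eq_bigr => m _; apply: eq_ncoef => i ip; rewrite nth_rcons ip.
Qed.

Lemma Acoef_parity s n : odd n != odd (size s) -> Acoef s n = 0.
Proof.
case/lastP: s => [|s a]; first by case: n.
by rewrite size_rcons Acoef_rcons => /negbTE ->; rewrite mulr0 !mul0r.
Qed.

Lemma Acoef_ge0 s n : 0 <= Acoef s n.
Proof.
elim/last_ind: s n => [|s a IHs] n; first by rewrite /Acoef /= ler0n.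
by rewrite Acoef_rcons !mulr_ge0 ?invr_ge0 ?exprn_ge0 ?ler0n ?sumr_ge0.
Qed.

(** The inner sum has [n] terms and [n ^- a] with [a >= 1] absorbs their number, so each entry costs
    only a factor 2. *)
Lemma Acoef_le s n : all (leq 1) s -> Acoef s n <= 2 ^+ size s.
Proof.
elim/last_ind: s n => [|s a IHs] n; first by rewrite /Acoef /= lern1 leq_b1.
rewrite all_rcons => /andP[a1 s1]; rewrite Acoef_rcons size_rcons.
case: n => [|n]; first by rewrite big_nil mulr0 exprn_ge0.
rewrite exprS -!mulrA ler_pM2l //.
apply: (@le_trans _ _ ((n.+1%:R ^+ a)^-1 * \sum_(0 <= m < n.+1) Acoef s m)).
  apply: ler_piMl; last by case: eqP.
  by rewrite mulr_ge0 ?invr_ge0 ?exprn_ge0 ?ler0n ?sumr_ge0 // => i _; exact: Acoef_ge0.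
rewrite mulrC ler_pdivrMr ?exprn_gt0 ?ltr0n //.
apply: (@le_trans _ _ (2 ^+ size s * n.+1%:R)).
  apply: le_trans (ler_sum _ (fun i _ => IHs i s1)) _.
  by rewrite sumr_const_nat subn0 mulr_natr.
rewrite ler_pM2l ?exprn_gt0 //; case: a a1 => // a _.
by rewrite exprS ler_peMr ?ler0n // exprn_ege1 // ler1n.
Qed.

Lemma Acoef_disk s : all (leq 1) s -> converges_on_disk (Acoef s).
Proof.
move=> s1; apply: (@bounded_converges_on_disk _ _ (2 ^+ size s)) => n.
by rewrite ger0_norm ?Acoef_ge0 ?Acoef_le.
Qed.

(** [limn] chooses from the set of limits, and a sequence and its shift have the same set; divergent
    sequences are covered too. *)
Lemma limn_shiftS (u : nat -> R) : limn (fun n => u n.+1) = limn u.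
Proof.
rewrite /lim /lim_in; congr (get _); apply/funext => l.
by rewrite /= (@cvg_shiftS _ u (nbhs l)).
Qed.

Lemma A_pseries s x : A s x = limn (pseries (Acoef s) x).
Proof.
(* The shift avoids the truncation at 0, where the empty tuple already contributes 1 while the power
   series has no term yet. *)
rewrite /A -limn_shiftS -[RHS]limn_shiftS; congr (limn _); apply/funext => N.
by rewrite /Apart (@sum_admissible R (nth 0%N s) (size s) N (fun n => x ^+ n)).
Qed.

Lemma is_cvg_pseries_Acoef s x :
  all (leq 1) s -> `|x| < 1 -> cvgn (pseries (Acoef s) x).
Proof. by move=> s1; exact/is_cvg_pseries_disk/Acoef_disk. Qed.

(** Differentiation brings down a factor [n], which turns [n ^- a.+1] into [n ^- a]. *)
Lemma is_derive_A_succ s a x : all (leq 1) (rcons s a) -> x != 0 -> `|x| < 1 ->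
  is_derive x 1 (A (rcons s a.+1)) (A (rcons s a) x / x).
Proof.
move=> s1 x0 x1.
have s1' : all (leq 1) (rcons s a.+1).
  by move: s1; rewrite !all_rcons => /andP[_ ->].
have := is_derive_pseries_disk (Acoef_disk s1') x1.
rewrite [X in is_derive _ _ X _](_ : _ = A (rcons s a.+1)); last first.
  by apply/funext => y; rewrite A_pseries.
move=> h; apply: (is_derive_eq h).
set d := pseries_diffs _.
have cvd : cvgn (pseries d x).
  exact/is_cvg_pseries_disk/x1/converges_on_disk_diffs/Acoef_disk.
apply: (canRL (mulfK x0)); rewrite A_pseries -[RHS]limn_shiftS.
apply/esym/cvg_lim => //.
rewrite (_ : (fun N => _) = (fun N => pseries d x N * x)).
  exact: cvgMr_tmp.
apply/funext => N; rewrite /pseries /series /= big_nat_recl //.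
(* The constant coefficient is an empty sum, so multiplying the formal derivative by [x] recovers
   every term. *)
rewrite Acoef_rcons big_nil mulr0 mul0r add0r mulr_suml.
apply: eq_bigr => n _; rewrite /d /pseries_diffs !Acoef_rcons [x ^+ n.+1]exprSr.
rewrite mulrA; congr (_ * _ * _).
rewrite [_ ^+ a.+1]exprS invfM.
have n0 : n.+1%:R != 0 :> R by rewrite pnatr_eq0.
by rewrite !mulrA; congr (_ / _ * _); field.
Qed.

(** The factor [n] cancels the exponent 1 and leaves partial sums of [Acoef s] at indices of one
    parity. Multiplication by [1 - x ^+ 2] takes differences at distance two; since [Acoef s] lives
    on that parity, each difference is a single coefficient, doubled. *)
Lemma is_derive_A_rcons1 s x : all (leq 1) s -> `|x| < 1 ->
  is_derive x 1 (A (rcons s 1%N)) (2 / (1 - x ^+ 2) * A s x).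
Proof.
move=> s1 x1.
have s1' : all (leq 1) (rcons s 1) by rewrite all_rcons.
have := is_derive_pseries_disk (Acoef_disk s1') x1.
rewrite [X in is_derive _ _ X _](_ : _ = A (rcons s 1%N)); last first.
  by apply/funext => y; rewrite A_pseries.
move=> h; apply: (is_derive_eq h); rewrite A_pseries.
set d := pseries_diffs _.
have dE n : d n = 2 * (odd n == odd (size s))%:R * \sum_(0 <= m < n.+1) Acoef s m.
  rewrite /d /pseries_diffs Acoef_rcons /= expr1 (inj_eq negb_inj).
  by field.
(* The first sum has two more terms because [x ^+ 2] shifts indices by two, which makes the identity
   exact for finite sums. *)
have d_rec N : \sum_(0 <= n < N.+2) d n * x ^+ n - x ^+ 2 * \sum_(0 <= n < N) d n * x ^+ n =
    2 * \sum_(0 <= n < N.+2) Acoef s n * x ^+ n.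
  have parity n : (odd n == odd (size s))%:R * Acoef s n = Acoef s n.
    by have [//|] := eqVneq; rewrite ?mul1r // mul0r => /Acoef_parity ->.
  elim: N => [|N IHN].
    rewrite !big_nat_recl // !big_nil !dE !big_nat_recl // !big_nil.
    have := parity 0%N; have := parity 1%N.
    rewrite /=; case: (odd (size s)) => /=; rewrite ?mul1r ?mul0r => h1 h0.
      by rewrite -h0; ring.
    by rewrite -h1; ring.
  rewrite [in LHS](big_nat_recr N.+2) // (big_nat_recr N) //= [in RHS]big_nat_recr //=.
  rewrite mulrDr opprD addrACA IHN mulrDr; congr (_ + _).
  rewrite !dE (big_nat_recr N.+2) // (big_nat_recr N.+1) //= negbK.
  have [eqN|neN] := eqVneq (odd N) (odd (size s)).
    have -> : Acoef s N.+1 = 0 by apply: Acoef_parity; rewrite /= eqN; case: odd.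
    by rewrite addr0 mulr1 !exprS; ring.
  by rewrite mulr0 !mul0r mulr0 subr0 [Acoef s _]Acoef_parity ?mul0r ?mulr0 //= negbK.
have cvd : cvgn (pseries d x).
  exact/is_cvg_pseries_disk/x1/converges_on_disk_diffs/Acoef_disk.
have cvc := is_cvg_pseries_Acoef s1 x1.
have x2 : 1 - x ^+ 2 != 0.
  by rewrite subr_eq0 eq_sym lt_eqF // -real_normK ?num_real // expr_lt1.
apply: (mulfI x2); rewrite mulrA mulrCA divff // mulr1.
have cvd2 : pseries d x N.+2 - x ^+ 2 * pseries d x N @[N --> \oo] -->
    limn (pseries d x) - x ^+ 2 * limn (pseries d x).
  apply: cvgB; last exact: cvgMl_tmp.
  by rewrite (cvg_shiftS (fun N => pseries d x N.+1)) cvg_shiftS.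
rewrite mulrBl mul1r; apply: (cvg_unique _ cvd2) => //.
rewrite (_ : (fun N => _) = (fun N => 2 * pseries (Acoef s) x N.+2)); last first.
  by apply/funext => N; exact: d_rec.
apply: cvgMl_tmp.
by rewrite (cvg_shiftS (fun N => pseries (Acoef s) x N.+1)) cvg_shiftS.
Qed.
End IteratedSums.

(** * Behaviour at the endpoint 1: criteria, growth bounds, Abel's theorem *)

Section LimitsAtOne.
Local Open Scope classical_set_scope.
Variable R : realType.
Implicit Types (s : seq nat) (x z : R) (f : R -> R).

(** [C] may depend on [e], which permits splitting a series at an index depending on [e]; [2^-1 < z]
    keeps [z] away from 0. *)
Lemma cvg_left1_0 f : (forall e, 0 < e -> exists C, forall z, 2^-1 < z < 1 ->
    `|f z| <= e + C * (1 - z)) -> f z @[z --> 1^'-] --> 0.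
Proof.
move=> hf; apply/cvgrPdist_le => e e0.
have e2 : 0 < e / 2 by rewrite divr_gt0.
have [C hC] := hf _ e2.
have C1 : 0 < `|C| + 1 by rewrite ltr_wpDl.
near=> z; rewrite sub0r normrN.
have z1 : z < 1 by near: z; exact: nbhs_left_lt.
apply: (@le_trans _ _ (e / 2 + C * (1 - z))).
  apply: hC; rewrite z1 andbT; near: z; apply: nbhs_left_gt.
  by rewrite invf_lt1 // ltr1n.
have : (1 - z) * (`|C| + 1) <= e / 2.
  rewrite -ler_pdivlMr //; apply/ltW; near: z; apply: nbhs_left_ltBl.
  by rewrite divr_gt0.
have : C * (1 - z) <= (1 - z) * (`|C| + 1).
  rewrite mulrC ler_wpM2l ?subr_ge0 ?(ltW z1) //.
  by rewrite (le_trans (ler_norm _)) // lerDl.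
by lra.
Unshelve. all: by end_near.
Qed.

(** By the mean value theorem [f] is constant to the right of each point, and the constant is its
    limit at 1. *)
Lemma eq0_of_is_derive0 f : (forall z, 0 < z < 1 -> is_derive z 1 f 0) ->
  f z @[z --> 1^'-] --> 0 -> forall z, 0 < z < 1 -> f z = 0.
Proof.
move=> df f0 x /andP[x0 x1].
have const y : x < y -> y < 1 -> f y = f x.
  move=> xy y1.
  have sub t : t \in `[x, y]%R -> 0 < t < 1.
    by rewrite in_itv /= => /andP[xt ty]; rewrite (lt_le_trans x0 xt) (le_lt_trans ty y1).
  have [t||t _] := @MVT _ f (fun=> 0) x y xy.
  - by move=> /subset_itv_oo_cc /sub; exact: df.
  - apply: derivable_within_continuous => t /sub /df [] //.
  - by rewrite mul0r => /eqP; rewrite subr_eq0 => /eqP.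
suff : f z @[z --> 1^'-] --> f x by move=> /(cvg_unique _ f0) ->.
apply: cvg_near_cst; near=> z.
apply: const; near: z; [exact: nbhs_left_gt | exact: nbhs_left_lt].
Unshelve. all: by end_near.
Qed.

Lemma pseries_le_limn (c : nat -> R) z N : (forall n, 0 <= c n) -> 0 <= z ->
  cvgn (pseries c z) -> pseries c z N <= limn (pseries c z).
Proof.
move=> c0 z0 cv; apply: nondecreasing_cvgn_le => //.
apply: nondecreasing_series => n _ _ /=.
by rewrite mulr_ge0 ?exprn_ge0.
Qed.

(** A form of Bernoulli's inequality. *)
Lemma sub_expr_le x n : 0 <= x <= 1 -> 1 - x ^+ n <= n%:R * (1 - x).
Proof.
move=> /andP[x0 x1]; elim: n => [|n IHn]; first by rewrite subrr mul0r.
have : 0 <= (1 - x) * (1 - x ^+ n) by rewrite mulr_ge0 ?subr_ge0 // exprn_ile1.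
by move: IHn; rewrite -natr1 exprS; lra.
Qed.

(** Abel's theorem for nonnegative coefficients: the value at [z] lies between [z ^+ N * S] and [L],
    where the partial sum [S] at 1 is within [e] of the full sum [L]. *)
Lemma abel_pseries_left1 (c : nat -> R) : (forall n, 0 <= c n) ->
  cvgn (pseries c 1) ->
  limn (pseries c z) - limn (pseries c 1) @[z --> 1^'-] --> 0.
Proof.
move=> c0 cv1; apply: cvg_left1_0 => e e0.
have := cv1; move/cvgrPdist_le => /(_ _ e0) [N _ /(_ N (leqnn _))].
set S := pseries c 1 N; set L := limn (pseries c 1) => hN.
have SL : S <= L by exact: pseries_le_limn.
have S0 : 0 <= S by apply: sumr_ge0 => i _; rewrite mulr_ge0 ?exprn_ge0.
exists (N%:R * S) => z /andP[z12 z1].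
have z0 : 0 < z by apply: lt_trans z12; rewrite invr_gt0.
have cvz : cvgn (pseries c z).
  by apply: (is_cvg_pseries_inside cv1); rewrite normr1 ger0_norm // ltW.
have le1 : limn (pseries c z) <= L.
  apply: ler_lim => //; apply: nearW => n; apply: ler_sum => i _ /=.
  by rewrite expr1n ler_wpM2l // exprn_ile1 // ltW.
have le2 : z ^+ N * S <= limn (pseries c z).
  apply: le_trans (pseries_le_limn N c0 (ltW z0) cvz).
  rewrite mulr_sumr big_nat [leRHS]big_nat; apply: ler_sum => i /andP[_ iN].
  rewrite /= expr1n mulr1 mulrC ler_wpM2l //.
  by apply: (ler_wiXn2l (ltW z0) (ltW z1)); exact: ltnW.
have : (1 - z ^+ N) * S <= N%:R * (1 - z) * S.
  by rewrite ler_wpM2r // sub_expr_le // !ltW.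
move: hN; rewrite ler_norml => /andP[_ hN] hz.
by rewrite ler_norml; apply/andP; split; lra.
Qed.

(** Comparison with a geometric series; the constant coefficient vanishes for nonempty [s], which
    yields the factor [x] and hence decay at 0. *)
Lemma A_le s x : all (leq 1) s -> s != [::] -> 0 < x < 1 ->
  0 <= A s x <= 2 ^+ size s * x / (1 - x).
Proof.
move=> s1 sn0 /andP[x0 x1]; have ax : `|x| < 1 by rewrite ger0_norm // ltW.
have cv := is_cvg_pseries_Acoef s1 ax.
rewrite A_pseries; apply/andP; split.
  apply: limr_ge => //; apply: nearW => N; apply: sumr_ge0 => i _.
  by rewrite mulr_ge0 ?Acoef_ge0 ?exprn_ge0 // ltW.
have Acoef0 : Acoef R s 0 = 0.
  case/lastP: s sn0 {cv s1} => // s a _.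
  by rewrite Acoef_rcons big_nil mulr0.
have cg := @cvg_geometric_series R (2 ^+ size s * x) x ax.
rewrite -(cvg_lim _ cg) // -limn_shiftS.
apply: ler_lim.
- apply: (cvgP (limn (pseries (Acoef R s) x))).
  by rewrite (cvg_shiftS (pseries (Acoef R s) x)).
- exact: cvgP cg.
apply: nearW => N; rewrite /pseries /series /= big_nat_recl // Acoef0 mul0r add0r.
apply: ler_sum => i _; rewrite exprS mulrA ler_wpM2r ?exprn_ge0 ?(ltW x0) //.
by rewrite ler_wpM2r ?(ltW x0) // Acoef_le.
Qed.

Lemma Acoef1 a n : Acoef R [:: a] n = 2 * (odd n)%:R / n%:R ^+ a.
Proof.
rewrite (Acoef_rcons R [::] a n) /= eqb_id; case: n => [|n].
  by rewrite big_nil !(mulr0, mul0r).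
by rewrite big_nat_recl // big1 // addr0 mulr1.
Qed.

(** Terms of index below [N] are at most 2, later ones at most [2 / N * z ^+ n]. This stands in for
    the logarithmic growth of [A [:: 1] z]: the multiple of [1 / (1 - z)] can be made arbitrarily
    small. *)
Lemma A1_le z N : (0 < N)%N -> 0 < z < 1 ->
  0 <= A [:: 1%N] z <= 2 * N%:R + 2 / N%:R / (1 - z).
Proof.
move=> N0 z01; have /andP[z0 z1] := z01.
have /andP[-> _] := @A_le [:: 1%N] z isT isT z01; rewrite andTb.
have az : `|z| < 1 by rewrite ger0_norm // ltW.
rewrite A_pseries; apply: limr_le; first exact: is_cvg_pseries_Acoef.
apply: nearW => M.
have cg := @cvg_geometric_series R (2 / N%:R) z az.
apply: (@le_trans _ _ (\sum_(0 <= n < M) (2 * (n < N)%N%:R + geometric (2 / N%:R) z n))).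
  apply: ler_sum => n _ /=; rewrite Acoef1 expr1.
  have zn1 : z ^+ n <= 1 by rewrite exprn_ile1 // ltW.
  have zn0 : 0 <= z ^+ n by rewrite exprn_ge0 // ltW.
  have o1 : (odd n)%:R <= 1 :> R by rewrite lern1 leq_b1.
  case: n zn1 zn0 o1 => [|n] zn1 zn0 o1.
    by rewrite mulr0 !mul0r N0 expr0 mulr1 addr_ge0 // divr_ge0.
  case: ltnP => [_|Nn].
    rewrite mulr1 -[leLHS]addr0; apply: lerD; last by rewrite mulr_ge0 // divr_ge0.
    apply: le_trans (_ : 2 * (odd n.+1)%:R / n.+1%:R <= _).
      by rewrite ler_piMr // divr_ge0 // mulr_ge0.
    rewrite ler_pdivrMr ?ltr0n // ler_pM2l //.
    by apply: le_trans o1 _; rewrite ler1n.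
  rewrite mulr0 add0r ler_wpM2r //; apply: ler_pM; rewrite ?mulr_ge0 ?invr_ge0 ?ler0n //.
  - by rewrite ler_piMr.
  - by rewrite lef_pV2 ?posrE ?ltr0n // ler_nat.
rewrite big_split /= lerD //.
  rewrite -mulr_sumr ler_pM2l // -natr_sum ler_nat.
  suff -> : (\sum_(0 <= n < M) (n < N) = minn M N)%N by exact: geq_minr.
  elim: M => [|M IHM]; first by rewrite big_nil min0n.
  by rewrite big_nat_recr //= IHM; case: (ltnP M N); lia.
rewrite -(cvg_lim _ cg) //; apply: nondecreasing_cvgn_le; last exact: cvgP cg.
apply: nondecreasing_series => n _ _ /=.
by rewrite mulr_ge0 ?exprn_ge0 ?divr_ge0 // ltW.
Qed.

Lemma is_cvg_pseries_Acoef1 n : (1 < n)%N -> cvgn (pseries (Acoef R [:: n]) 1).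
Proof.
move=> n1; apply: nondecreasing_is_cvgn.
  apply: nondecreasing_series => i _ _ /=.
  by rewrite mulr_ge0 ?Acoef_ge0 ?exprn_ge0.
(* This bound propagates by telescoping, from [1 / (u + 1) ^+ 2 <= 1 / u - 1 / (u + 1)]; it is an
   equality at [N = 0]. *)
suff h N : pseries (Acoef R [:: n]) 1 N.+2 <= 4 - 2 / N.+1%:R.
  exists 4 => _ [N _ <-]; apply: (@le_trans _ _ (pseries (Acoef R [:: n]) 1 N.+2)).
    apply: nondecreasing_series => [i _ _ /=|]; last by rewrite -addn2 leq_addr.
    by rewrite mulr_ge0 ?Acoef_ge0 ?exprn_ge0.
  by apply: le_trans (h N) _; rewrite gerBl divr_ge0.
elim: N => [|N IHN]; rewrite /pseries /series /=.
  rewrite !big_nat_recl // big_nil !Acoef1 /= !expr1n !mulr0 !mul0r.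
  by lra.
rewrite big_nat_recr //= expr1n mulr1.
apply: le_trans (lerD IHN (lexx _)) _.
rewrite Acoef1; set u : R := N.+1%:R.
have u1 : 1 <= u by rewrite ler1n.
have uE : N.+2%:R = u + 1 :> R by rewrite natr1.
have : 2 * (odd N.+2)%:R / N.+2%:R ^+ n <= 2 / (u + 1) ^+ 2 :> R.
  apply: ler_pM; rewrite ?mulr_ge0 ?invr_ge0 ?exprn_ge0 //.
    by rewrite -[leRHS]mulr1 ler_pM2l // lern1 leq_b1.
  rewrite uE lef_pV2 ?posrE ?exprn_gt0; try lra.
  by apply: ler_weXn2l; first lra.
have : 2 / (u + 1) ^+ 2 <= 2 / u - 2 / (u + 1) :> R.
  have -> : 2 / u - 2 / (u + 1) = 2 / (u * (u + 1)) by field; lra.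
  rewrite ler_pM2l // lef_pV2 ?posrE ?exprn_gt0 ?mulr_gt0; try lra.
rewrite uE => h1 h2; apply: le_trans (lerD (lexx _) (le_trans h2 h1)) _.
by rewrite addrA subrK.
Qed.

Lemma T_A n : (1 < n)%N -> T R n = A [:: n] 1.
Proof.
move=> n1; have cv := @is_cvg_pseries_Acoef1 n n1.
rewrite A_pseries /T.
suff h : (fun N : nat => \sum_(1 <= m < N | odd m) (m%:R ^- n : R)) =
    (fun N => 2^-1 * pseries (Acoef R [:: n]) 1 N).
  have c2 := cvgMl_tmp (a := 2^-1) cv.
  by rewrite h (cvg_lim _ (c2 _)) // mulrA divff ?mul1r.
apply/funext => N; rewrite /pseries /series /= mulr_sumr big_mkcond /=.
case: N => [|N]; first by rewrite !big_geq.
rewrite big_add1 /= [RHS]big_nat_recl // Acoef1 /= mulr0 !mul0r mulr0 add0r.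
apply: eq_bigr => m _; rewrite Acoef1 expr1n mulr1 !mulrA mulVf // mul1r.
by rewrite [odd m.+1]/=; case: (odd m); rewrite /= ?mul1r ?mul0r.
Qed.

End LimitsAtOne.

(** * The substitution [w z = (1 - z) / (1 + z)] *)

Section Duality.
Local Open Scope classical_set_scope.
Variable R : realType.
Implicit Types (s : seq nat) (x z : R).

Let w z := (1 - z) / (1 + z).

Lemma is_derive_cayley z : 0 < z -> is_derive z 1 w (- 2 / (1 + z) ^+ 2).
Proof.
move=> z0; have z1 : 1 + z != 0 by rewrite gt_eqF // ltr_pwDl // ltW.
have d1 : is_derive z 1 (fun y : R => 1 - y) (- 1).
  by rewrite -[- 1]add0r; apply: is_deriveB.
have d2 : is_derive z 1 (fun y : R => 1 + y) 1.
  by rewrite -[X in is_derive _ _ _ X]add0r; apply: is_deriveD.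
have d3 := is_deriveM d1 (is_deriveV (f := fun y => 1 + y) z1 d2).
apply: (is_derive_eq d3); rewrite /GRing.scale /=.
by field.
Qed.

Lemma cayley_itv z : 0 < z < 1 -> 0 < w z < 1.
Proof.
move=> /andP[z0 z1]; have p : 0 < 1 + z by lra.
by rewrite /w divr_gt0 ?subr_gt0 //= ltr_pdivrMr // mul1r; lra.
Qed.

(** For [w = (1 - z) / (1 + z)] one has [2 dw / (1 - w^2) = - dz / z]. *)
Lemma is_derive_A_cayley_rcons1 s z : all (leq 1) s -> 0 < z < 1 ->
  is_derive z 1 (fun y => A (rcons s 1%N) (w y)) (- (A s (w z) / z)).
Proof.
move=> s1 z01; have /andP[z0 z1] := z01; have /andP[w0 w1] := cayley_itv z01.
have aw : `|w z| < 1 by rewrite ger0_norm // ltW.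
have d := is_derive1_comp (is_derive_A_rcons1 s1 aw) (is_derive_cayley z0).
apply: (is_derive_eq d).
have p : 1 + z != 0 by rewrite gt_eqF //; lra.
have -> : 1 - w z ^+ 2 = 4 * z / (1 + z) ^+ 2 by rewrite /w; field.
by field; rewrite p gt_eqF.
Qed.

(** Here the relation is [dw / w = - 2 dz / (1 - z^2)]. *)
Lemma is_derive_A_cayley_succ s a z : all (leq 1) (rcons s a) -> 0 < z < 1 ->
  is_derive z 1 (fun y => A (rcons s a.+1) (w y))
    (- (2 / (1 - z ^+ 2) * A (rcons s a) (w z))).
Proof.
move=> s1 z01; have /andP[z0 z1] := z01; have /andP[w0 w1] := cayley_itv z01.
have aw : `|w z| < 1 by rewrite ger0_norm // ltW.
have wn0 : w z != 0 by rewrite gt_eqF.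
have d := is_derive1_comp (is_derive_A_succ s1 wn0 aw) (is_derive_cayley z0).
apply: (is_derive_eq d); rewrite /w.
have p : 1 + z != 0 by rewrite gt_eqF //; lra.
have q : 1 - z != 0 by rewrite gt_eqF //; lra.
have -> : 1 - z ^+ 2 = (1 - z) * (1 + z) by ring.
by field; rewrite p q.
Qed.

Lemma A_nil x : A [::] x = 1.
Proof.
rewrite /A -limn_shiftS; apply: cvg_lim => //.
rewrite (_ : (fun N => _) = (fun=> 1)); first exact: cvg_cst.
apply/funext => N.
rewrite /Apart (@sum_admissible R (nth 0%N [::]) 0 N (fun n => x ^+ n)).
rewrite big_nat_recl //= expr0 mulr1 big1 ?addr0 // => i _.
by rewrite mul0r.
Qed.

(** * Both sides as functions of [z], and their derivatives *)

Let G m z := A (nseq m 1%N) (w z).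
Let P n z := A [:: n] z.
(** Here [j] counts the leading ones, so it is one less than the position of the entry 2. *)
Let H j m z := A (nseq j 1%N ++ 2%N :: nseq m 1%N) (w z).

Lemma nseqSr (T : Type) m (a : T) : nseq m.+1 a = rcons (nseq m a) a.
Proof. by rewrite -addn1 nseqD cats1. Qed.

Lemma all_nseq1 m : all (leq 1) (nseq m 1%N).
Proof. by rewrite all_nseq orbT. Qed.

Definition dG m z : R := if m is m'.+1 then - (G m' z / z) else 0.

Lemma is_derive_G m z : 0 < z < 1 -> is_derive z 1 (G m) (dG m z).
Proof.
case: m => [|m] z01 /=.
  rewrite (_ : G 0 = cst 1); last by apply/funext => y; exact: A_nil.
  exact: is_derive_cst.
have := is_derive_A_cayley_rcons1 (all_nseq1 m) z01.
by rewrite -nseqSr.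
Qed.

Definition dP n z : R := if n is 1%N then 2 / (1 - z ^+ 2) else P n.-1 z / z.

Lemma is_derive_P n z : 0 < z < 1 -> is_derive z 1 (P n.+1) (dP n.+1 z).
Proof.
move=> /andP[z0 z1]; have az : `|z| < 1 by rewrite ger0_norm // ltW.
case: n => [|n] /=.
  by have := @is_derive_A_rcons1 R [::] z isT az; rewrite A_nil mulr1.
by apply: (@is_derive_A_succ R [::]) => //; rewrite gt_eqF.
Qed.

Lemma is_derive_H0 j z : 0 < z < 1 ->
  is_derive z 1 (H j 0) (- (2 / (1 - z ^+ 2) * G j.+1 z)).
Proof.
move=> z01; have := @is_derive_A_cayley_succ (nseq j 1%N) 1 z.
by rewrite -nseqSr => /(_ (all_nseq1 _) z01); rewrite -cats1.
Qed.

Lemma is_derive_HS j m z : 0 < z < 1 ->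
  is_derive z 1 (H j m.+1) (- (H j m z / z)).
Proof.
move=> z01.
have h : all (leq 1) (nseq j 1%N ++ 2%N :: nseq m 1%N).
  by rewrite all_cat /= !all_nseq1.
have := is_derive_A_cayley_rcons1 h z01.
by rewrite rcons_cat rcons_cons -nseqSr.
Qed.

Definition T_sum j m z := \sum_(i < m.+1)
  (-1) ^+ i * 'C(i + j, i)%:R * T R (i + j + 1) * G (m - i) z.

(** The second sum of the right-hand side without its sign, for [m = r - j] and with [l] shifted by
    [m]; in it and in [T_sum], [j] is the position of the entry 2. *)
Definition A_sum j m z := \sum_(l < j.+1)
  'C(m + l, m)%:R * (G (j - l) z * P (m + l).+1 z).

Lemma is_derive_bigsum n (h : 'I_n -> R -> R) (dh : 'I_n -> R) z :
  (forall i, is_derive z 1 (h i) (dh i)) ->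
  is_derive z 1 (fun y => \sum_(i < n) h i y) (\sum_(i < n) dh i).
Proof. by move=> hd; rewrite -fct_sumE; exact: is_derive_sum. Qed.

(** The summand [i = m] is constant, and the coefficients do not involve [m], so lowering every
    [G (m - i)] gives the sum for [m - 1]. *)
Lemma is_derive_T_sum j m z : 0 < z < 1 ->
  is_derive z 1 (T_sum j m) (if m is m'.+1 then - (T_sum j m' z / z) else 0).
Proof.
move=> z01.
have d : is_derive z 1 (T_sum j m) (\sum_(i < m.+1)
    (-1) ^+ i * 'C(i + j, i)%:R * T R (i + j + 1) * dG (m - i) z).
  by apply: is_derive_bigsum => i; apply/is_deriveZ/is_derive_G.
apply: (is_derive_eq d); rewrite big_ord_recr /= subnn /= mulr0 addr0.
case: m d => [|m] d; first by rewrite big_ord0.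
rewrite /T_sum mulr_suml -sumrN; apply: eq_bigr => i _.
by rewrite subSn ?leq_ord //= mulrN mulrA.
Qed.

(** The product rule gives two sums, one lowering [P] and one lowering [G]; an index shift matches
    their products, and Pascal's rule combines the coefficients. *)
Lemma is_derive_A_sum j m z : 0 < z < 1 -> is_derive z 1 (A_sum j m)
  (if m is m'.+1 then A_sum j m' z / z else 2 / (1 - z ^+ 2) * G j z).
Proof.
move=> z01.
have d : is_derive z 1 (A_sum j m) (\sum_(l < j.+1) 'C(m + l, m)%:R *
    (G (j - l) z * dP (m + l).+1 z + P (m + l).+1 z * dG (j - l) z)).
  apply: is_derive_bigsum => l; apply/is_deriveZ.
  by apply: is_deriveM; [exact: is_derive_G | exact: is_derive_P].
apply: (is_derive_eq d).
under eq_bigr do rewrite mulrDr.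
rewrite big_split /= [X in _ + X]big_ord_recr /= subnn /= !mulr0 addr0.
have shift : \sum_(i < j) 'C(m + i, m)%:R * (P (m + i).+1 z * dG (j - i) z) =
    - (\sum_(i < j) 'C(m + i, m)%:R * (P (m + i).+1 z * G (j - i.+1) z)) / z.
  rewrite mulNr mulr_suml -sumrN; apply: eq_bigr => i _.
  by rewrite -(subnSK (ltn_ord i)) /= mulrN; field;
    case/andP: z01 => z0 _; rewrite gt_eqF.
rewrite shift mulNr; case: m {d shift} => [|m].
  (* For [m = 0] all binomials are 1 and the sums cancel, except for the term with the derivative of
     [P 1]. *)
  rewrite big_ord_recl /= bin0 mul1r subn0 mulrC.
  rewrite -[RHS]addr0 -addrA; congr (_ + _).
  apply/eqP; rewrite subr_eq0 mulr_suml; apply/eqP/eq_bigr => i _.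
  by rewrite /bump /= add1n !add0n !bin0 -mulrA; congr (_ * _);
     rewrite /dP mulrA [G _ _ * _]mulrC.
have -> : A_sum j m z =
    \sum_(l < j.+1) 'C(m.+1 + l, m.+1)%:R * (G (j - l) z * P (m + l).+1 z)
    - \sum_(l < j.+1) 'C(m + l, m.+1)%:R * (G (j - l) z * P (m + l).+1 z).
  rewrite -sumrB; apply: eq_bigr => l _.
  by rewrite -mulrBl addSn binS natrD addrAC subrr add0r.
rewrite mulrBl; congr (_ - _ / _).
  by rewrite mulr_suml; apply: eq_bigr => l _; rewrite addSn /= !mulrA.
(* The summand [l = 0] carries the binomial of [m] over [m.+1], which is 0; the rest is the shifted
   sum. *)
rewrite [RHS]big_ord_recl /= addn0 bin_small // mul0r add0r.
apply: eq_bigr => i _.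
by rewrite /bump /= add1n addnS addSn [G _ _ * _]mulrC.
Qed.

(** * Limits of both sides as [z] tends to 1 from the left *)

Lemma cvg_cayley_left1 s : all (leq 1) s -> s != [::] ->
  A s (w z) @[z --> 1^'-] --> 0.
Proof.
move=> s1 sn0; apply: cvg_left1_0 => e e0.
exists (2 ^+ size s) => z /andP[z12 z1].
have z01 : 0 < z < 1 by rewrite z1 andbT; lra.
have /andP[z0 _] := z01.
have /andP[A0 A1] := A_le s1 sn0 (cayley_itv z01).
rewrite ger0_norm //; apply: le_trans A1 _.
(* For [z > 1/2] the last factor is at most [1 - z]. *)
have -> : 2 ^+ size s * w z / (1 - w z) = 2 ^+ size s * ((1 - z) / (2 * z)).
  rewrite /w; field; rewrite gt_eqF //=; apply/andP; split; rewrite gt_eqF; lra.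
apply: ler_wpDl; first exact: ltW.
rewrite ler_pM2l ?exprn_gt0 // ler_piMr ?subr_ge0 ?(ltW z1) //.
by rewrite invf_le1 ?mulr_gt0 //; lra.
Qed.

(** [G m.+1] decays like [1 - z], which beats the logarithmic divergence of [P 1]. *)
Lemma cvg_GP_left1 m : G m.+1 z * P 1 z @[z --> 1^'-] --> 0.
Proof.
apply: cvg_left1_0 => e e0.
pose K : R := 2 ^+ m.+1 * 2.
have K0 : 0 < K by rewrite mulr_gt0 ?exprn_gt0.
(* [N] exceeds [K / e], so the part of the product that does not decay, [K / N], is at most [e]. *)
pose N := (Num.truncn (K / e)).+1.
have KN : K / N%:R <= e.
  rewrite ler_pdivrMr ?ltr0n // mulrC -ler_pdivrMr //.
  by apply/ltW; exact: truncnS_gt.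
exists (K * N%:R) => z /andP[z12 z1].
have z01 : 0 < z < 1 by rewrite z1 andbT; lra.
have /andP[z0 _] := z01.
have /andP[G0 G1] := A_le (all_nseq1 m.+1) isT (cayley_itv z01).
have /andP[P0 P1] := @A1_le R z N isT z01.
rewrite ger0_norm ?mulr_ge0 //.
apply: le_trans (ler_pM G0 P0 G1 P1) _.
have N0 : N%:R != 0 :> R by rewrite pnatr_eq0.
rewrite size_nseq.
have -> : 2 ^+ m.+1 * w z / (1 - w z) * (2 * N%:R + 2 / N%:R / (1 - z)) =
    (K / N%:R + K * N%:R * (1 - z)) * (2 * z)^-1.
  rewrite /w /K; field; rewrite N0 /=; do ?(apply/andP; split); rewrite gt_eqF; lra.
apply: (@le_trans _ _ (K / N%:R + K * N%:R * (1 - z))); last by rewrite lerD2r.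
apply: ler_piMr; last by rewrite invf_le1 ?mulr_gt0 //; lra.
by rewrite addr_ge0 ?divr_ge0 ?mulr_ge0 ?subr_ge0 // ltW.
Qed.

Lemma cvg_P_left1 n : (1 < n)%N -> P n z - T R n @[z --> 1^'-] --> 0.
Proof.
move=> n1; rewrite T_A // A_pseries.
rewrite (_ : P n = fun z => limn (pseries (Acoef R [:: n]) z)); last first.
  by apply/funext => z; exact: A_pseries.
by apply: abel_pseries_left1; [exact: Acoef_ge0 | exact: is_cvg_pseries_Acoef1].
Qed.

Lemma cvg_left1_0Ml (a : R) (f : R -> R) :
  f z @[z --> 1^'-] --> 0 -> a * f z @[z --> 1^'-] --> 0.
Proof. by move=> f0; rewrite -[X in _ --> X](mulr0 a); exact: cvgMl_tmp. Qed.

Lemma cvg_bigsum0 n (h : 'I_n -> R -> R) :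
  (forall i, h i z @[z --> 1^'-] --> 0) ->
  \sum_(i < n) h i z @[z --> 1^'-] --> 0.
Proof.
elim: n h => [|n IHn] h h0.
  rewrite (_ : (fun z => _) = cst 0); first exact: cvg_cst.
  by apply/funext => z; rewrite big_ord0.
rewrite (_ : (fun z => _) =
    (fun z => \sum_(i < n) h (widen_ord (leqnSn n) i) z + h ord_max z)).
  rewrite -[X in _ --> X](addr0 0); apply: cvgD => //.
  exact: (IHn (fun i => h (widen_ord (leqnSn n) i))).
by apply/funext => z; rewrite big_ord_recr.
Qed.

Lemma cvg_G_left1 m : (0 < m)%N -> G m z @[z --> 1^'-] --> 0.
Proof. by case: m => // m _; apply: cvg_cayley_left1; rewrite ?all_nseq1. Qed.

(* Only the last summands of [T_sum] and [A_sum] survive at [z = 1]; they have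
   the same coefficient and cancel. *)
Lemma cvg_rhs_left1 j m :
  T_sum j.+1 m z - (-1) ^+ m * A_sum j.+1 m z @[z --> 1^'-] --> 0.
Proof.
set J := j.+1.
pose r1 z :=
  \sum_(i < m) (-1) ^+ i * 'C(i + J, i)%:R * T R (i + J + 1) * G (m - i) z.
pose r2 z := \sum_(l < J) 'C(m + l, m)%:R * (G (J - l) z * P (m + l).+1 z).
have r1_0 : r1 z @[z --> 1^'-] --> 0.
  by apply: cvg_bigsum0 => i; apply/cvg_left1_0Ml/cvg_G_left1; rewrite subn_gt0.
have r2_0 : r2 z @[z --> 1^'-] --> 0.
  (* The case [m + l = 0] is separate because [P 1] diverges at 1, whereas the later [P n.+2] have
     the finite limits [T R n.+2]. *)
  apply: cvg_bigsum0 => l; apply: cvg_left1_0Ml; case: (m + l)%N => [|n].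
    by rewrite -(subnSK (ltn_ord l)); exact: cvg_GP_left1.
  rewrite -[X in _ --> X](mul0r (0 + T R n.+2)); apply: cvgM.
    by apply: cvg_G_left1; rewrite subn_gt0.
  rewrite (_ : P n.+2 = fun z => P n.+2 z - T R n.+2 + T R n.+2); last first.
    by apply/funext => z; rewrite subrK.
  by apply: cvgD; [exact: cvg_P_left1 | exact: cvg_cst].
have PT : P (m + J).+1 z - T R (m + J).+1 @[z --> 1^'-] --> 0.
  by apply: cvg_P_left1; rewrite addnS.
rewrite (_ : (fun z => _) = (fun z => r1 z - (-1) ^+ m * r2 z
   - (-1) ^+ m * 'C(m + J, m)%:R * (P (m + J).+1 z - T R (m + J).+1))).
  have -> : 0 = 0 - (-1) ^+ m * 0 - (-1) ^+ m * 'C(m + J, m)%:R * 0 :> R by ring.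
  by apply: cvgB; [apply: cvgB => // |]; exact: cvgMl_tmp.
apply/funext => z; rewrite /T_sum /A_sum (big_ord_recr m) (big_ord_recr J) /=.
rewrite !subnn -/(r1 z) -/(r2 z).
by rewrite [G 0 z]A_nil addn1; ring.
Qed.

(** * Induction on the number of trailing ones *)

Lemma A_cayley_duality j m z : 0 < z < 1 ->
  H j m z = T_sum j.+1 m z - (-1) ^+ m * A_sum j.+1 m z.
Proof.
pose D m y := H j m y - (T_sum j.+1 m y - (-1) ^+ m * A_sum j.+1 m y).
suff D0 y : 0 < y < 1 -> D m y = 0 by move=> /D0/eqP; rewrite subr_eq0 => /eqP.
have D_left1 n : D n y @[y --> 1^'-] --> 0.
  rewrite -[X in _ --> X](subr0 0); apply: cvgB; last exact: cvg_rhs_left1.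
  by apply: cvg_cayley_left1; rewrite ?all_cat /= ?all_nseq1 //; case: (j).
(* The derivative of [D 0] cancels outright; that of [D m.+1] is [- D m y / y], which is 0 by
   induction. *)
elim: m y => [|m IHm]; apply: eq0_of_is_derive0 => // y y01.
  have d := is_deriveB (is_derive_H0 j y01) (is_deriveB
    (is_derive_T_sum j.+1 0 y01) (is_deriveZ ((-1) ^+ 0) (is_derive_A_sum j.+1 0 y01))).
  by apply: (is_derive_eq d); rewrite /= expr0 /GRing.scale /=; ring.
have d := is_deriveB (is_derive_HS j m y01) (is_deriveB
  (is_derive_T_sum j.+1 m.+1 y01) (is_deriveZ ((-1) ^+ m.+1) (is_derive_A_sum j.+1 m.+1 y01))).
have /eqP := IHm y y01; rewrite subr_eq0 => /eqP HE.
by apply: (is_derive_eq d); rewrite /= HE exprS /GRing.scale /=; ring.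
Qed.

End Duality.

Theorem theorem2p8 (R : realType) (j r : nat) (z : R)
    (j_gt0 : (0 < j)%N) (le_jr : (j <= r)%N) (z_gt0 : 0 < z) (z_lt1 : z < 1) :
  A (nseq j.-1 1%N ++ 2%N :: nseq (r - j) 1%N) ((1 - z) / (1 + z)) =
    \sum_(0 <= i < (r - j).+1)
      (-1) ^+ i * 'C(i + j, i)%:R * T R (i + j + 1) *
      A (nseq (r - j - i) 1%N) ((1 - z) / (1 + z))
    + (-1) ^ (r%:Z - j%:Z - 1) *
      \sum_(r - j <= l < r.+1)
        'C(l, r - j)%:R * A (nseq (r - l) 1%N) ((1 - z) / (1 + z)) *
        A [:: l.+1] z.
Proof.
case: j j_gt0 le_jr => // j _ le_jr.
rewrite subzn //; move: (r - j.+1)%N (subnK le_jr) => m <- {r le_jr}.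
rewrite A_cayley_duality ?z_gt0 //; congr (_ + _); first by rewrite big_mkord.
(* The exponent [m - 1] is an integer, equal to -1 when [r = j]; splitting off its -1 yields the
   minus sign. *)
rewrite expfzDr ?oppr_eq0 ?oner_eq0 // exprN1 invrN1 mulrN1 mulNr; congr (- (_ * _)).
rewrite -{2}[m]add0n big_addn -addnS addKn big_mkord; apply: eq_bigr => l _.
by rewrite [(l + m)%N]addnC subnDl mulrA.
Qed.
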